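(* Let $(X,\mathcal A,\nu)$ be a $\sigma$-finite measure space and $k$ be a bounded, measurable kernel on $X$ with reproducing kernel Hilbert space $H$ for which the map $I_{k,\nu}:H\to L_2(\nu)$, $f\mapsto[f]_\sim$, is (well-defined,) compact and injective. Let $(\lambda_i)_{i\in I}$ and $(e_i)_{i\in I}$ be the eigenvalues and eigenfunctions of $T_{k,\nu}$ described in the context. Then for all $[h]_\sim,[g]_\sim\in\Delta(\nu)$ and $P:=h\,\mathrm d\nu$, $Q:=g\,\mathrm d\nu$ the kernel mean distance can be computed by $$\gamma_k^2(P,Q)=\sum_{i\in I}\lambda_i\,\langle[h-g]_\sim,[e_i]_\sim\rangle_{L_2(\nu)}^2.$$ Moreover, the following statements are equivalent: (i) There exist $Q_1,Q_2\in\mathcal P_2(\nu)$ with $Q_1\ne Q_2$ and $\gamma_k^2(Q_1,Q_2)=0$. (ii) There exists an $[f]_\sim\in L_1(\nu)\cap[H]_\sim^\perp$ with $[f]_\sim\ne0$ and $\int_X f\,\mathrm d\nu=0$. (iii) There exist $[h_1]_\sim,[h_2]_\sim\in\Delta(\nu)$ with $[h_1]_\sim\ne[h_2]_\sim$ such that $\langle[h_1]_\sim,[e_i]_\sim\rangle_{L_2(\nu)}=\langle[h_2]_\sim,[e_i]_\sim\rangle_{L_2(\nu)}$ for all $i\in I$. Moreover, if one, and thus all, of these statements are true, then for all $P\in\mathcal P_2(\nu)$ and $\varepsilon\in(0,2)$ there exist $Q_1,Q_2\in\mathcal P_2(\nu)$ with $\|P-Q_i\|_{\mathrm{TV}}\le\varepsilon$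 for $i=1,2$, $\|Q_1-Q_2\|_{\mathrm{TV}}=\varepsilon$, and $\gamma_k^2(Q_1,Q_2)=0$.
   Context: A kernel on $X$ is a symmetric positive definite function $k:X\times X\to\mathbb R$ (i.e. $\sum_{i,j}a_ia_jk(x_i,x_j)\ge0$ for all finite choices). $[f]_\sim$ denotes the $\nu$-equivalence class of a measurable function $f$, and $L_p(\nu)$ the usual real space of $\nu$-equivalence classes. $[H]_\sim:=\{[h]_\sim:h\in H\}$ and $[H]_\sim^\perp$ is its orthogonal complement in $L_2(\nu)$. For probability measures $P,Q$ on $X$, $\gamma_k(P,Q):=\|\Phi(P)-\Phi(Q)\|_H$ with $\Phi(\mu):=\int_X k(\cdot,x)\,\mathrm d\mu(x)\in H$ (Pettis integral). $\|\cdot\|_{\mathrm{TV}}$ is the total variation norm, $\|\mu\|_{\mathrm{TV}}=|\mu|(X)$. $\Delta(\nu):=\{[h]_\sim\in L_2(\nu)\cap L_1(\nu):[h]_\sim\ge0\text{ and }\int_Xh\,\mathrm d\nu=1\}$ and $\mathcal P_2(\nu):=\{h\,\mathrm d\nu:[h]_\sim\in\Delta(\nu)\}$, where $h\,\mathrm d\nu$ is the measure with $\nu$-density $h$. Let $T_{k,\nu}:=I_{k,\nu}\circ I_{k,\nu}^*:L_2(\nu)\to L_2(\nu)$, i.e. $T_{k,\nu}f=[\int_Xk(x,\cdot)f(x)\,\mathrm d\nu(x)]_\sim$; it is compact, positive and self-adjoint. $(\lambda_i)_{i\in I}\subset(0,\infty)$ is the at most countable family of its non-zero eigenvalues including multiplicities,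 and $(e_i)_{i\in I}\subset H$ is a family such that $([e_i]_\sim)_{i\in I}$ is an orthonormal system in $L_2(\nu)$ of corresponding eigenfunctions and $(\sqrt{\lambda_i}e_i)_{i\in I}$ is an orthonormal system in $H$. Since $I_{k,\nu}$ is injective, $(\sqrt{\lambda_i}e_i)_{i\in I}$ is in fact an orthonormal basis of $H$ and $k(x,x')=\sum_{i\in I}\lambda_ie_i(x)e_i(x')$ for all $x,x'\in X$. *)

(* Defs.v *)
From HB Require Import structures.
From mathcomp Require Import all_boot all_order all_algebra.
From mathcomp Require Import all_classical all_reals all_analysis.

Set Implicit Arguments.
Unset Strict Implicit.
Unset Printing Implicit Defensive.

Import Order.TTheory GRing.Theory Num.Theory.
Import numFieldNormedType.Exports.

Local Open Scope classical_set_scope.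
Local Open Scope ring_scope.

Definition psd_kernel (R : realType) (X : Type) (k : X -> X -> R) : Prop :=
  (forall x y, k x y = k y x) /\
  (forall (n : nat) (x : 'I_n -> X) (a : 'I_n -> R),
    0 <= \sum_(i < n) \sum_(j < n) a i * a j * k (x i) (x j)).

Definition bounded_kernel (R : realType) (X : Type) (k : X -> X -> R) : Prop :=
  exists M : R, forall x y, `|k x y| <= M.

(* A Hilbert space whose elements are, through the injective linear map
   [rkhs_fun], functions X -> R; [rkhs_section x] is k(., x). It is determined
   by k up to a unique isometry compatible with [rkhs_fun]. *)
Record rkhs (R : realType) (X : Type) (k : X -> X -> R) := RKHS {
  rkhs_space :> completeNormedModType R ;
  rkhs_dot : {dot rkhs_space for idfun} ;
  rkhs_normE : forall f : rkhs_space, `|f| ^+ 2 = rkhs_dot f f ;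
  rkhs_fun : rkhs_space -> X -> R ;
  rkhs_fun_linear : forall (a : R) (f g : rkhs_space) (x : X),
    rkhs_fun (a *: f + g) x = a * rkhs_fun f x + rkhs_fun g x ;
  rkhs_fun_inj : injective rkhs_fun ;
  rkhs_section : X -> rkhs_space ;
  rkhs_sectionE : forall x y, rkhs_fun (rkhs_section x) y = k y x ;
  rkhs_reproducing : forall (f : rkhs_space) (x : X),
    rkhs_fun f x = rkhs_dot f (rkhs_section x)
}.

Arguments rkhs_dot {R X k} H : rename.
Arguments rkhs_fun {R X k H} f x : rename.
Arguments rkhs_section {R X k} H x : rename.

(* Elements of L_p(nu) are represented by functions in [Lfun nu p], and
   equality of classes by [f = g %[ae nu]]. *)
Section L2.
Context {R : realType} {d : measure_display} {X : measurableType d}.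
Variable nu : {measure set X -> \bar R}.
Implicit Types f g h : X -> R.

Definition L2dot f g : R := \int[nu]_x (f x * g x).

Definition Delta : set (X -> R) := [set h |
  [/\ h \in Lfun nu 2%:E, h \in Lfun nu 1%E,
      {ae nu, forall x, 0 <= h x} &
      (\int[nu]_x (h x)%:E = 1)%E]].

Definition has_density (P : probability X R) h : Prop :=
  forall A, measurable A -> P A = (\int[nu]_(x in A) (h x)%:E)%E.

Definition P2 : set (probability X R) :=
  [set P | exists2 h, Delta h & has_density P h].

(* So quantifying over P with [has_density P h] is not vacuous. *)
Lemma Delta_has_density h : Delta h -> exists P, has_density P h.
Proof.
case=> _ /Lfun1_integrable hi h0 h1.
have hpi := integrable_funepos measurableT hi.
have hpE A : measurable A ->
    (\int[nu]_(x in A) (EFin \o h)^\+ x = \int[nu]_(x in A) (h x)%:E)%E.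
  move=> mA; apply: ae_eq_integral => //.
  - by apply: (measurable_int nu); apply: integrableS hpi.
  - by apply: (measurable_int nu); apply: integrableS hi.
  apply: filterS h0 => x hx _.
  by rewrite funeposE /= max_l.
have p0 A : (0 <= induced_charge hpi A)%E.
  by apply: integral_ge0 => x _; exact: funepos_ge0.
have m1 : measure_of_charge (induced_charge hpi) p0 setT = 1%E.
  by rewrite /measure_of_charge /induced_charge hpE.
pose pM := Measure_isProbability.Build _ _ _
  (measure_of_charge (induced_charge hpi) p0) m1.
pose P : probability X R :=
  HB.pack (measure_of_charge (induced_charge hpi) p0) pM.
by exists P => A mA; rewrite /= /measure_of_charge /induced_charge hpE.
Qed.

(* The operator T_{k,nu} of L_2(nu). *)
Definition integral_operator (k : X -> X -> R) f : X -> R :=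
  fun y => \int[nu]_x (k x y * f x).

End L2.

(* The values of P and Q at non-measurable sets are meaningless, so Leibniz
   equality of measures would be too fine. *)
Definition same_measure (R : realType) (d : measure_display)
    (X : measurableType d) (P Q : probability X R) : Prop :=
  forall A, measurable A -> P A = Q A.

Section total_variation.
Context {R : realType} {d : measure_display} {X : measurableType d}.

Lemma hahn_ex (mu : {charge set X -> \bar R}) :
  exists PN : set X * set X, hahn_decomposition mu PN.1 PN.2.
Proof. by have [P [N PN]] := Hahn_decomposition mu; exists (P, N). Qed.

(* |mu|(X); independent of the chosen Hahn decomposition. *)
Definition tv_norm (mu : {charge set X -> \bar R}) : \bar R :=
  charge_variation (projT2 (cid (hahn_ex mu))) setT.

Definition tv_dist (P Q : probability X R) : \bar R :=
  tv_norm (cadd (charge_of_finite_measure P)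
                (copp (charge_of_finite_measure Q))).

End total_variation.

Section kernel_mean.
Context {R : realType} {d : measure_display} {X : measurableType d}.
Context {k : X -> X -> R} (H : rkhs k).

(* Continuous functionals on H are the maps [rkhs_dot H f]. *)
Definition is_pettis_integral (mu : {measure set X -> \bar R}) (F : X -> H)
    (m : H) : Prop :=
  forall f : H,
    mu.-integrable setT (fun x => (rkhs_dot H f (F x))%:E) /\
    rkhs_dot H f m = \int[mu]_x rkhs_dot H f (F x).

(* There is at most one Pettis integral; 0 if there is none. *)
Definition pettis_integral (mu : {measure set X -> \bar R}) (F : X -> H) : H :=
  xget 0 [set m | is_pettis_integral mu F m].

Definition kernel_mean_embedding (mu : {measure set X -> \bar R}) : H :=
  pettis_integral mu (rkhs_section H).

Definition kernel_mean_dist (P Q : probability X R) : R :=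
  `|kernel_mean_embedding P - kernel_mean_embedding Q|.

End kernel_mean.

Section embedding.
Context {R : realType} {d : measure_display} {X : measurableType d}.
Variable nu : {measure set X -> \bar R}.
Context {k : X -> X -> R} (H : rkhs k).

Definition L2_embedding_wd : Prop :=
  forall f : H, rkhs_fun f \in Lfun nu 2%:E.

Definition L2_embedding_inj : Prop :=
  forall f g : H, rkhs_fun f = rkhs_fun g %[ae nu] -> f = g.

Definition L2_embedding_compact : Prop :=
  forall u : nat -> H, (exists M : R, forall n, `|u n| <= M) ->
  exists (phi : nat -> nat) (g : X -> R),
    [/\ {homo phi : m n / (m < n)%N}, g \in Lfun nu 2%:E &
        Lnorm nu 2%:E (fun x => (rkhs_fun (u (phi n)) x - g x)%:E)
          @[n --> \oo] --> 0%E].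

Definition L2_perp : set (X -> R) := [set f |
  f \in Lfun nu 2%:E /\ forall g : H, L2dot nu f (rkhs_fun g) = 0].

(* All non-zero eigenvalues occur, each as often as its multiplicity: the
   [e i] with [lam i = t] span the eigenspace of [t], hence by orthonormality
   form a basis of it. *)
Record eigensystem (J : countType) (lam : J -> R) (e : J -> H) : Prop := {
  eigen_gt0 : forall i, 0 < lam i ;
  eigenE : forall i, integral_operator nu k (rkhs_fun (e i)) =
    (fun x => lam i * rkhs_fun (e i) x) %[ae nu] ;
  eigen_total : forall (t : R) (f : X -> R), t != 0 -> f \in Lfun nu 2%:E ->
    integral_operator nu k f = (fun x => t * f x) %[ae nu] ->
    exists (s : seq J) (c : J -> R), (forall i, i \in s -> lam i = t) /\
      f = (fun x => \sum_(i <- s) c i * rkhs_fun (e i) x) %[ae nu] ;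
  eigen_orthonormal_L2 : forall i j,
    L2dot nu (rkhs_fun (e i)) (rkhs_fun (e j)) = (i == j)%:R ;
  eigen_orthonormal_rkhs : forall i j,
    rkhs_dot H (Num.sqrt (lam i) *: e i) (Num.sqrt (lam j) *: e j)
      = (i == j)%:R
}.

End embedding.

(* Main.v *)
(** A density [h] in Delta has kernel mean [S h], where [S] is the adjoint of
    the embedding of [H] into L_2; hence gamma_k(P, Q) is the [H]-norm of
    [S (h - g)]. The formula is Parseval's identity for the orthonormal system
    [Num.sqrt (lam i) *: e i]. This system is total: [S], restricted to the
    orthogonal complement of the [e i], is a compact self-adjoint operator
    which is positive definite because the embedding is injective, so unless
    the complement is zero it has an eigenvector there, which [eigen_total]
    expands in the [e i].

    A distance zero means that [h - g] is orthogonal to [H] in L_2. Conversely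
    the positive and negative parts of an integrable [f] orthogonal to [H] with
    integral 0 normalize to two densities [h1], [h2] at L_1-distance 2, and the
    mixtures [(1 - eps / 2) *: h + (eps / 2) *: h1], and the same with [h2],
    have the required total variation distances. *)
Require Import Defs.
From HB Require Import structures.
From mathcomp Require Import all_boot all_order all_algebra.
From mathcomp Require Import all_classical all_reals all_analysis.
From mathcomp Require Import measurable_realfun ring lra.
Import Order.TTheory GRing.Theory Num.Theory.
Import numFieldNormedType.Exports.
Set Implicit Arguments.
Unset Strict Implicit.
Unset Printing Implicit Defensive.

Local Open Scope classical_set_scope.
Local Open Scope ring_scope.

(** Vectors within [n.+1%:R^-1] of an extremum of a quadratic functional carry norm errors of this
    square-root order. *)
Lemma cvg_sqrt_harmonic (R : realType) :
  Num.sqrt n.+1%:R^-1 @[n --> \oo] --> (0 : R).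
Proof.
rewrite -[X in _ --> X](@sqrtr0 R).
apply: (@cvg_comp _ _ _ (fun n => n.+1%:R^-1) (@Num.sqrt R)).
  exact: cvg_harmonic.
exact: sqrt_continuous.
Qed.

(** * Hilbert space tools: Cauchy-Schwarz, Riesz representation, Parseval *)

Section hilbert_space.
Context (R : realType) (V : completeNormedModType R) (dot : {dot V for idfun}).
Hypothesis normE : forall f : V, `|f| ^+ 2 = dot f f.
Implicit Types f g h : V.

Lemma dotC f g : dot f g = dot g f.
Proof. by rewrite hermC /= expr0 mul1r. Qed.

Lemma dotDl f g h : dot (f + g) h = dot f h + dot g h.
Proof. exact: linearDl. Qed.
Lemma dotBl f g h : dot (f - g) h = dot f h - dot g h.
Proof. exact: linearBl. Qed.
Lemma dotZl a f h : dot (a *: f) h = a * dot f h.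
Proof. exact: linearZl_LR. Qed.
Lemma dotDr f g h : dot h (f + g) = dot h f + dot h g.
Proof. exact: linearDr. Qed.
Lemma dotBr f g h : dot h (f - g) = dot h f - dot h g.
Proof. exact: linearBr. Qed.
Lemma dotZr a f h : dot h (a *: f) = a * dot h f.
Proof. exact: linearZr_LR. Qed.
Lemma dot0l h : dot 0 h = 0.
Proof. exact: linear0l. Qed.
Lemma dot0r h : dot h 0 = 0.
Proof. exact: linear0r. Qed.

Lemma dot_eq0 f : dot f f = 0 -> f = 0.
Proof. by rewrite -normE => /eqP; rewrite sqrf_eq0 normr_eq0 => /eqP. Qed.

Lemma dot_ge0 f : 0 <= dot f f.
Proof. by rewrite -normE sqr_ge0. Qed.

(** The value at the minimizer [- b / c] gives the bound. All Cauchy-Schwarz inequalities below, and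
    the estimate for minimizing sequences, come from this. *)
Lemma discr_le0 (a b c : R) : 0 <= c ->
  (forall t, 0 <= a + 2 * t * b + t ^+ 2 * c) -> b ^+ 2 <= a * c.
Proof.
rewrite le_eqVlt => /orP[/eqP <- h|c0 h].
  rewrite mulr0; have [->|b0] := eqVneq b 0; first by rewrite expr0n.
  (* For [c = 0] the polynomial is affine, and this argument gives it the value -1. *)
  have := h (- (a + 1) / (2 * b)).
  have -> : a + 2 * (- (a + 1) / (2 * b)) * b + (- (a + 1) / (2 * b)) ^+ 2 * 0
    = -1 by field.
  by rewrite oppr_ge0 ler10.
have := h (- b / c).
have -> : a + 2 * (- b / c) * b + (- b / c) ^+ 2 * c = (a * c - b ^+ 2) / c.
  by field; exact: lt0r_neq0.
by rewrite pmulr_lge0 ?invr_gt0// subr_ge0.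
Qed.

Lemma dot_CS f g : dot f g ^+ 2 <= dot f f * dot g g.
Proof.
apply: discr_le0 (dot_ge0 g) _ => t.
have := dot_ge0 (f + t *: g).
rewrite !dotDl !dotDr !dotZl !dotZr (dotC g f); lra.
Qed.

Lemma ler_norm_dot f g : `|dot f g| <= `|f| * `|g|.
Proof.
rewrite -(@ler_pXn2r _ 2) ?nnegrE ?mulr_ge0//.
by rewrite exprMn !normE -normrX ger0_norm ?sqr_ge0// dot_CS.
Qed.

Lemma cvg_dotl (T : Type) (F : set_system T) (FF : Filter F) (u : T -> V) f g :
  u x @[x --> F] --> f -> dot (u x) g @[x --> F] --> dot f g.
Proof.
move=> /cvgrPdist_lt uf; apply/cvgrPdist_lt => e e0.
have g0 : 0 < `|g| + 1 by rewrite ltr_wpDl.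
have /uf := divr_gt0 e0 g0; apply: filterS => x; rewrite ltr_pdivlMr// => h.
rewrite -dotBl (le_lt_trans (ler_norm_dot _ _))//.
by rewrite (le_lt_trans _ h)// ler_wpM2l// lerDl.
Qed.

(* Any sequence minimizing [|f|^2 - 2 L f] over [W] converges to [w]. *)
Lemma functional_represented (W : set V) (L : V -> R) (C : R) :
  W 0 -> (forall a f g, W f -> W g -> W (a *: f + g)) ->
  (forall a f g, L (a *: f + g) = a * L f + L g) ->
  (forall f, `|L f| <= C * `|f|) ->
  exists w, closure W w /\ forall f, W f -> dot w f = L f.
Proof.
move=> W0 WP LP LC.
have WB f g : W f -> W g -> W (f - g).
  by move=> Wf Wg; rewrite addrC -scaleN1r; exact: WP.
pose J f := dot f f - 2 * L f.
have JC f : - C ^+ 2 <= J f.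
  have := LC f; rewrite /J -normE => h.
  have : L f <= C * `|f| by rewrite (le_trans (ler_norm _) h).
  have := sqr_ge0 (`|f| - C); rewrite !expr2; lra.
have Jinf : has_inf (J @` W).
  split; first by exists (J 0); exists 0.
  by exists (- C ^+ 2) => _ [f _ <-].
have ltJ n : exists f, W f /\ J f < inf (J @` W) + n.+1%:R^-1.
  have n0 : 0 < n.+1%:R^-1 :> R by rewrite invr_gt0.
  by have [_ [f Wf <-] h] := inf_adherent n0 Jinf; exists f.
have [u uP] := choice ltJ.
have Wu n : W (u n) by have [] := uP n.
(* Moving from [u n] by [t *: f] lowers [J] by at most [n.+1%:R^-1]; this is a nonnegative quadratic
   polynomial in [t], whose discriminant bounds the defect of [u n]. *)
have uL n f : W f -> (dot (u n) f - L f) ^+ 2 <= n.+1%:R^-1 * `|f| ^+ 2.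
  move=> Wf; apply: discr_le0 => [|t]; first exact: sqr_ge0.
  have [_ h] := uP n.
  have : inf (J @` W) <= J (t *: f + u n).
    by apply: ge_inf; [exact: Jinf.2|exists (t *: f + u n) => //; exact: WP].
  move: (inf _) h => I; rewrite /J normE LP !dotDl !dotDr !dotZl !dotZr.
  rewrite (dotC f (u n)).
  set N := _^-1; lra.
(* The estimates [uL] for [u n] and [u m] are both tested on their difference; subtracting them
   cancels [L]. *)
have uu n m : `|u n - u m| <= Num.sqrt n.+1%:R^-1 + Num.sqrt m.+1%:R^-1.
  have uLs p : `|dot (u p) (u n - u m) - L (u n - u m)|
      <= Num.sqrt p.+1%:R^-1 * `|u n - u m|.
    rewrite -(@ler_pXn2r _ 2) ?nnegrE ?mulr_ge0 ?sqrtr_ge0//.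
    rewrite exprMn sqr_sqrtr ?invr_ge0// real_normK ?num_real//.
    exact: uL (WB _ _ (Wu n) (Wu m)).
  have [->|un0] := eqVneq (u n - u m) 0; first by rewrite normr0 addr_ge0.
  have u0 : 0 < `|u n - u m| by rewrite normr_gt0.
  rewrite -(ler_pM2r u0) -expr2 normE {1}dotBl mulrDl.
  rewrite (le_trans _ (lerD (uLs n) (uLs m)))//.
  by rewrite (le_trans _ (ler_normB _ _))// (le_trans _ (ler_norm _))//; lra.
have s0 := @cvg_sqrt_harmonic R.
have cu : cvg (u @ \oo).
  apply/cauchy_cvgP/cauchy_exP => e e0.
  have : \forall n \near \oo, `|0 - Num.sqrt n.+1%:R^-1 : R| < e / 2.
    by move/cvgrPdist_lt : s0; apply; rewrite divr_gt0.
  case=> N _ hN; exists (u N).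
  exists N => // n Nn /=; rewrite -ball_normE /=.
  have {}hN p : (N <= p)%N -> Num.sqrt p.+1%:R^-1 < e / 2.
    by move=> /hN /=; rewrite sub0r normrN ger0_norm.
  by rewrite (le_lt_trans (uu _ _))// [ltRHS]splitr ltrD// hN.
set w := lim (u @ \oo).
exists w; split.
  apply: (closed_cvg (closure W) (@closed_closure _ W) _ _ cu).
  by near=> n; apply: subset_closure.
move=> f Wf; apply/eqP; rewrite -subr_eq0; apply/eqP.
have d1 : dot (u n) f - L f @[n --> \oo] --> dot w f - L f.
  by apply: cvgB; [exact: cvg_dotl|exact: cvg_cst].
apply: (cvg_unique _ d1) => //; apply: norm_cvg0.
have d0 : Num.sqrt n.+1%:R^-1 * `|f| @[n --> \oo] --> (0 : R).
  by rewrite -(mul0r `|f|); apply: cvgMl.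
apply: squeeze_cvgr (cvg_cst 0) d0; near=> n; rewrite normr_ge0/=.
rewrite -(@ler_pXn2r _ 2) ?nnegrE ?mulr_ge0 ?sqrtr_ge0//.
by rewrite exprMn sqr_sqrtr ?invr_ge0// real_normK ?num_real// uL.
Unshelve. all: by end_near. Qed.

Lemma riesz_representation (L : V -> R) (C : R) :
  (forall a f g, L (a *: f + g) = a * L f + L g) ->
  (forall f, `|L f| <= C * `|f|) -> exists w, forall f, dot w f = L f.
Proof.
move=> LP LC.
have [//|//|w [_ wL]] := @functional_represented setT L C _ _ LP LC.
by exists w => f; exact: wL.
Qed.

Section parseval.
Context (J : choiceType) (b : J -> V).
Hypothesis bb : forall i j, dot (b i) (b j) = (i == j)%:R.

Let proj (s : seq J) f := \sum_(i <- s) dot f (b i) *: b i.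

Lemma dot_suml (I : Type) (s : seq I) (F : I -> V) g :
  dot (\sum_(i <- s) F i) g = \sum_(i <- s) dot (F i) g.
Proof. by elim/big_ind2 : _ => [|_ x _ y <- <-|]; rewrite ?dot0l ?dotDl. Qed.

Let dot_projb s f i : uniq s -> i \in s -> dot (proj s f) (b i) = dot f (b i).
Proof.
move=> us si; rewrite dot_suml (bigD1_seq i)//= big1 => [|j ji].
  by rewrite dotZl bb eqxx mulr1 addr0.
by rewrite dotZl bb (negbTE ji) mulr0.
Qed.

Let dot_projB s f : uniq s -> dot (f - proj s f) (f - proj s f)
  = dot f f - \sum_(i <- s) dot f (b i) ^+ 2.
Proof.
move=> us; have fp : dot (f - proj s f) (proj s f) = 0.
  rewrite dotC dot_suml big_seq big1// => i si.
  by rewrite dotZl (dotC (b _)) dotBl dot_projb// subrr mulr0.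
rewrite dotBr fp subr0 dotBl; congr (_ - _).
by rewrite dot_suml; apply: eq_bigr => i _; rewrite dotZl (dotC (b _)) expr2.
Qed.

Lemma bessel s f : uniq s -> \sum_(i <- s) dot f (b i) ^+ 2 <= dot f f.
Proof. by move=> us; rewrite -subr_ge0 -dot_projB// dot_ge0. Qed.

(** The representative [w] of [dot f] on the span [W] has the same coefficients as [f], so totality
    forces [w = f] and [f] lies in the closure of [W]. Bessel gives one inequality, approximation of
    [f] from [W] the other up to any [e]. *)
Lemma parseval f : (forall g, (forall i, dot g (b i) = 0) -> g = 0) ->
  (\esum_(i in [set: J]) (dot f (b i) ^+ 2)%:E = (dot f f)%:E)%E.
Proof.
move=> tot.
pose W := [set v | exists s : seq (R * J), v = \sum_(p <- s) p.1 *: b p.2].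
have W0 : W 0 by exists [::]; rewrite big_nil.
have WP a g h : W g -> W h -> W (a *: g + h).
  move=> [s ->] [t ->]; exists ([seq (a * p.1, p.2) | p <- s] ++ t).
  rewrite big_cat big_map scaler_sumr; congr (_ + _).
  by apply: eq_bigr => p _; rewrite scalerA.
have [||w [Ww wf]] := @functional_represented W (dot f) `|f| W0 WP.
- by move=> a g h; rewrite dotDr dotZr.
- by move=> g; exact: ler_norm_dot.
have {w wf Ww} Wf : closure W f.
  suff <- : w = f by [].
  apply/eqP; rewrite -subr_eq0; apply/eqP; apply: tot => i.
  rewrite dotBl wf ?subrr//; exists [:: (1, i)].
  by rewrite big_seq1 scale1r.
apply/eqP; rewrite eq_le; apply/andP; split.
  apply: ge_ereal_sup => _ [A [finA _] <-].
  rewrite fsbig_finite//= sumEFin lee_fin.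
  exact: bessel.
apply/lee_addgt0Pr => e e0.
have se0 : 0 < Num.sqrt e by rewrite sqrtr_gt0.
have [_ [[t ->]]] := Wf _ (nbhsx_ballx f _ se0).
set v := \sum_(p <- t) _; rewrite -ball_normE /= => fv.
(* An index may occur several times in [t], while [proj] needs each one once. *)
pose s := undup [seq p.2 | p <- t].
have us : uniq s by exact: undup_uniq.
(* Pythagoras: [v] lies in the span of the [b i] with [i] in [s], and [proj s f] is its point
   nearest to [f]. *)
have fps : dot (f - proj s f) (f - proj s f) <= dot (f - v) (f - v).
  have fpv : dot (f - proj s f) (proj s f - v) = 0.
    rewrite dotC dotBl; apply/eqP; rewrite subr_eq0; apply/eqP.
    transitivity (0 : R).
      rewrite dot_suml big_seq big1// => i si.
      by rewrite dotZl (dotC (b _)) dotBl dot_projb// subrr mulr0.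
    rewrite dot_suml big_seq big1// => p pt.
    rewrite dotZl (dotC (b _)) dotBl dot_projb ?subrr ?mulr0//.
    by rewrite mem_undup map_f.
  have -> : f - v = (f - proj s f) + (proj s f - v) by rewrite addrA subrK.
  move: (f - _) (_ - v) fpv => x y xy.
  rewrite dotDl !dotDr xy (dotC y x) xy addr0 add0r lerDl.
  exact: dot_ge0.
have lee : dot f f <= \sum_(i <- s) dot f (b i) ^+ 2 + e.
  move: fps; rewrite dot_projB// -(normE (f - v)) lerBlDl => /le_trans; apply.
  rewrite lerD2l -[leRHS](sqr_sqrtr (ltW e0)).
  by rewrite ler_pXn2r ?nnegrE ?sqrtr_ge0// ltW.
apply: (@le_trans _ _ ((\sum_(i <- s) dot f (b i) ^+ 2)%:E + e%:E)%E).
  by rewrite -EFinD lee_fin.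
rewrite leeD2r// -sumEFin; apply: ereal_sup_ubound.
exists [set` s]; last by rewrite -fsbig_seq.
by split.
Qed.

End parseval.

End hilbert_space.

Arguments dotC {R V dot}.

(** * Eigenvectors of compact positive symmetric operators *)

Section rayleigh.
Context (R : realType) (V : completeNormedModType R) (dot : {dot V for idfun}).
Hypothesis normE : forall f : V, `|f| ^+ 2 = dot f f.
Implicit Types f g : V.
Context (T : V -> V) (C : R).
Hypothesis TP : forall a f g, T (a *: f + g) = a *: T f + T g.
Hypothesis Tsym : forall f g, dot (T f) g = dot f (T g).
Hypothesis T_ge0 : forall f, 0 <= dot (T f) f.
Hypothesis TC : forall f, `|T f| <= C * `|f|.
Hypothesis Tcompact : forall u : nat -> V, (forall n, `|u n| = 1) ->
  exists (phi : nat -> nat) (w : V), {homo phi : m n / (m < n)%N} /\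
    T (u (phi n)) @[n --> \oo] --> w.

Let T_CS f g : dot (T f) g ^+ 2 <= dot (T f) f * dot (T g) g.
Proof.
apply: discr_le0 (T_ge0 g) _ => t.
have := T_ge0 (t *: g + f).
rewrite TP !dotDl !dotDr !dotZl !dotZr (Tsym g f) (dotC g (T f)); lra.
Qed.

(* A sequence of unit vectors maximizing [dot (T f) f] over [W] consists of
   approximate eigenvectors, because [|T f|^2 <= M dot (T f) f] on [W]. *)
Lemma rayleigh_eigenvector (W : set V) : closed W ->
  (forall a f g, W f -> W g -> W (a *: f + g)) -> (forall f, W f -> W (T f)) ->
  (exists2 f, W f & dot (T f) f != 0) ->
  exists w M, [/\ W w, w != 0, M != 0 & T w = M *: w].
Proof.
move=> cW WP WT [f0 Wf0 Tf0].
have TZ a f : T (a *: f) = a *: T f.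
  have T0 : T 0 = 0.
    by have := TP (-1) 0 0; rewrite scaler0 addr0 scaleN1r addNr.
  by have := TP a f 0; rewrite T0 !addr0.
have WZ a f : W f -> W (a *: f).
  have W0 : W 0 by have := WP (-1) _ _ Wf0 Wf0; rewrite scaleN1r addNr.
  by move=> Wf; rewrite -[_ *: _]addr0; exact: WP.
pose E := [set dot (T f) f | f in W `&` [set f | `|f| = 1]].
have unitE f : W f -> f != 0 -> E (dot (T f) f / `|f| ^+ 2).
  move=> Wf f1; have nf : `|f| != 0 by rewrite normr_eq0.
  exists (`|f|^-1 *: f).
    split; first exact: WZ.
    by rewrite /= normrZ normfV normr_id mulVf.
  by rewrite TZ dotZl dotZr; field.
have ubE : has_sup E.
  split.
    exists (dot (T f0) f0 / `|f0| ^+ 2); apply: unitE => //.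
    by apply: contra_neq Tf0 => ->; rewrite dot0r.
  exists C => _ [f [Wf f1] <-].
  rewrite (le_trans (ler_norm _))// (le_trans (ler_norm_dot normE _ _))//.
  by rewrite (le_trans (ler_wpM2r _ (TC _)))// f1 !mulr1.
pose M := sup E.
have qM f : W f -> dot (T f) f <= M * `|f| ^+ 2.
  have [-> _|f1 Wf] := eqVneq f 0; first by rewrite dot0r normr0 expr0n mulr0.
  rewrite -ler_pdivrMr ?exprn_gt0 ?normr_gt0//.
  by apply: ub_le_sup; [exact: ubE.2|exact: unitE].
have M0 : 0 < M.
  have f00 : f0 != 0 by apply: contra_neq Tf0 => ->; rewrite dot0r.
  have := qM _ Wf0; rewrite -ler_pdivrMr ?exprn_gt0 ?normr_gt0//.
  apply: lt_le_trans; rewrite divr_gt0 ?exprn_gt0 ?normr_gt0//.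
  by rewrite lt_neqAle eq_sym Tf0 T_ge0.
(* [T_CS] tested at [T f] bounds the fourth power of the norm of [T f] by
   [dot (T f) f * dot (T (T f)) (T f)]; the last factor is controlled by [qM], since [W] is
   invariant. *)
have TM f : W f -> `|T f| ^+ 2 <= M * dot (T f) f.
  move=> Wf; have [->|Tf] := eqVneq (T f) 0.
    by rewrite normr0 expr0n dot0l mulr0.
  have n0 : 0 < `|T f| ^+ 2 by rewrite exprn_gt0 ?normr_gt0.
  rewrite -(ler_pM2r n0) {1 2}normE -expr2 (le_trans (T_CS _ _))//.
  by rewrite [leRHS]mulrAC mulrC ler_wpM2r// qM//; exact: WT.
have ex_u n : exists u, [/\ W u, `|u| = 1 & M - n.+1%:R^-1 < dot (T u) u].
  have n0 : 0 < n.+1%:R^-1 :> R by rewrite invr_gt0.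
  by have [_ [u [Wu u1] <-] h] := sup_adherent n0 ubE; exists u.
have [u uP] := choice ex_u.
(* By [TM] the expanded square is at most [M * (M - dot (T (u n)) (u n))]. *)
have Tu n : `|T (u n) - M *: u n| ^+ 2 <= M * n.+1%:R^-1.
  have [Wu u1 h] := uP n.
  rewrite normE dotBl !dotBr !dotZl !dotZr -!normE (dotC (u n)) u1.
  have := TM _ Wu; move: h; set N := _^-1 => h.
  have : M * (M - N) <= M * dot (T (u n)) (u n) by rewrite ler_pM2l// ltW.
  lra.
have u1 n : `|u n| = 1 by have [] := uP n.
have [phi [w [hphi Tw]]] := Tcompact u1.
(* Compactness makes [T (u (phi n))] converge, and its distance to [M *: u (phi n)] tends to 0. *)
have Mu_w : M *: u (phi n) @[n --> \oo] --> w.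
  have phi_ge n : (n <= phi n)%N.
    by elim: n => // n ih; rewrite (leq_ltn_trans ih)// hphi.
  have d0 : T (u (phi n)) - M *: u (phi n) @[n --> \oo] --> (0 : V).
    apply: norm_cvg0.
    have e0 : Num.sqrt M * Num.sqrt n.+1%:R^-1 @[n --> \oo] --> (0 : R).
      by rewrite -(mulr0 (Num.sqrt M)); apply: cvgMr; exact: cvg_sqrt_harmonic.
    apply: squeeze_cvgr (cvg_cst 0) e0; near=> n; rewrite normr_ge0/=.
    rewrite -(@ler_pXn2r _ 2) ?nnegrE ?mulr_ge0 ?sqrtr_ge0//.
    rewrite (le_trans (Tu _))// exprMn !sqr_sqrtr ?invr_ge0// ?(ltW M0)//.
    by rewrite ler_pM2l// lef_pV2 ?posrE// ler_nat ltnS.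
  rewrite -[w]subr0.
  have -> : (fun n => M *: u (phi n)) =
      (fun n => T (u (phi n)) - (T (u (phi n)) - M *: u (phi n))).
    by apply/funext => n; rewrite subKr.
  exact: cvgB.
have Ww : W w.
  by apply: (closed_cvg W cW _ _ Mu_w); near=> n; apply: WZ; have [] := uP (phi n).
exists w, M; split=> //.
- rewrite -normr_gt0; suff -> : `|w| = M by [].
  apply: (@cvg_unique _ _ (`|M *: u (phi n)| @[n --> \oo])) => //.
    exact: cvg_norm.
  rewrite (_ : (fun _ => _) = cst M); first exact: cvg_cst.
  by apply/funext => n /=; rewrite normrZ u1 mulr1 gtr0_norm.
- exact: lt0r_neq0.
(* [Tsym] moves [T] onto the test vector [f], so that both sides are limits of the same sequence of
   inner products. *)
- suff h f : dot (T w) f = dot (M *: w) f.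
    apply/eqP; rewrite -subr_eq0; apply/eqP; apply: (dot_eq0 normE).
    by rewrite dotBl h subrr.
  apply: (@cvg_unique _ _ (dot (M *: u (phi n)) (T f) @[n --> \oo])) => //.
    by rewrite Tsym; exact: cvg_dotl.
  have -> : (fun n => dot (M *: u (phi n)) (T f)) =
      (fun n => M * dot (T (u (phi n))) f).
    by apply/funext => n; rewrite dotZl Tsym.
  by rewrite dotZl; apply: cvgMr; exact: cvg_dotl.
Unshelve. all: by end_near. Qed.

End rayleigh.

(** * The inner product of L_2 on representatives *)

Section L2_space.
Context (R : realType) (d : measure_display) (X : measurableType d).
Context (nu : {measure set X -> \bar R}).
Implicit Types f g h : X -> R.

Lemma Lfun_measurable p f : f \in Lfun nu p -> measurable_fun setT f.
Proof. by case/andP; rewrite inE. Qed.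

Lemma Lfun2P a f g : f \in Lfun nu 2%:E -> g \in Lfun nu 2%:E ->
  a *: f + g \in Lfun nu 2%:E.
Proof. by move=> lf lg; apply: (Lfun_submod_closed nu (lee1n 2)).2. Qed.

Lemma Lfun2Z a f : f \in Lfun nu 2%:E -> a *: f \in Lfun nu 2%:E.
Proof.
move=> lf; rewrite -[a *: f]addr0; apply: Lfun2P => //.
exact: (Lfun_submod_closed nu (lee1n 2)).1.
Qed.

Lemma Lfun2B f g : f \in Lfun nu 2%:E -> g \in Lfun nu 2%:E ->
  f - g \in Lfun nu 2%:E.
Proof. by move=> lf lg; rewrite addrC -scaleN1r; exact: Lfun2P. Qed.

Lemma Lfun2_mul_integrable f g : f \in Lfun nu 2%:E -> g \in Lfun nu 2%:E ->
  nu.-integrable setT (EFin \o (fun x => f x * g x)).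
Proof. by move=> lf lg; apply/Lfun1_integrable; exact: Lfun2_mul_Lfun1. Qed.

Lemma L2dotC f g : L2dot nu f g = L2dot nu g f.
Proof. by apply: eq_Rintegral => x _; rewrite mulrC. Qed.

Lemma L2dotPl a f g h : f \in Lfun nu 2%:E -> g \in Lfun nu 2%:E ->
  h \in Lfun nu 2%:E ->
  L2dot nu (a *: f + g) h = a * L2dot nu f h + L2dot nu g h.
Proof.
move=> lf lg lh; have ifh := Lfun2_mul_integrable lf lh.
rewrite /L2dot -RintegralZl// -RintegralD//=.
- by apply: eq_Rintegral => x _; rewrite !fctE mulrDl mulrA.
- by apply: eq_integrable (integrableZl measurableT a ifh).
- exact: Lfun2_mul_integrable.
Qed.

Lemma L2dot0l f : L2dot nu 0 f = 0.
Proof.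
transitivity (\int[nu]_x (cst 0 x : R)); last by rewrite Rintegral_cst// mul0r.
by apply: eq_Rintegral => x _; exact: mul0r.
Qed.

Lemma L2dotZl a f g : f \in Lfun nu 2%:E -> g \in Lfun nu 2%:E ->
  L2dot nu (a *: f) g = a * L2dot nu f g.
Proof.
move=> lf lg; rewrite -[a *: f]addr0 L2dotPl// ?L2dot0l ?addr0//.
exact: (Lfun_submod_closed nu (lee1n 2)).1.
Qed.

Lemma L2dotBl f g h : f \in Lfun nu 2%:E -> g \in Lfun nu 2%:E ->
  h \in Lfun nu 2%:E -> L2dot nu (f - g) h = L2dot nu f h - L2dot nu g h.
Proof.
by move=> lf lg lh; rewrite addrC -scaleN1r L2dotPl// mulN1r addrC.
Qed.

Lemma L2dot_ge0 f : 0 <= L2dot nu f f.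
Proof. by apply: Rintegral_ge0 => x _; rewrite -expr2 sqr_ge0. Qed.

(** The right side exceeds the left by the squared L_2 norm of [f - 2 g]. It serves to bound the
    norms along an L_2-convergent sequence. *)
Lemma L2dot_le_sub f g : f \in Lfun nu 2%:E -> g \in Lfun nu 2%:E ->
  L2dot nu f f <= 2 * L2dot nu (f - g) (f - g) + 2 * L2dot nu g g.
Proof.
move=> lf lg; have := L2dot_ge0 ((-2) *: g + f).
rewrite L2dotBl ?Lfun2B// !(L2dotC _ (_ - _)) !L2dotBl//.
rewrite L2dotPl ?Lfun2P// !(L2dotC _ (_ + _)) !L2dotPl// (L2dotC g f).
lra.
Qed.

Lemma L2dot_CS f g : f \in Lfun nu 2%:E -> g \in Lfun nu 2%:E ->
  L2dot nu f g ^+ 2 <= L2dot nu f f * L2dot nu g g.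
Proof.
move=> lf lg; apply: discr_le0 (L2dot_ge0 g) _ => t.
have := L2dot_ge0 (t *: g + f).
rewrite !(L2dotPl,Lfun2P)// !(L2dotC _ (_ + _)) !(L2dotPl,Lfun2P)// (L2dotC g f).
lra.
Qed.

Lemma Lnorm2_L2dot f : f \in Lfun nu 2%:E ->
  Lnorm nu 2%:E (EFin \o f) = (Num.sqrt (L2dot nu f f))%:E.
Proof.
move=> lf; rewrite unlock/= -powR12_sqrt ?L2dot_ge0// -poweR_EFin; congr (_ `^ _)%E.
rewrite /L2dot /Rintegral fineK.
  by apply: eq_integral => x _; rewrite /= powR_mulrn// real_normK ?num_real// expr2.
by apply: integrable_fin_num => //; exact: Lfun2_mul_integrable.
Qed.

Lemma L2dot_eq0 f : f \in Lfun nu 2%:E -> L2dot nu f f = 0 ->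
  f = cst 0 %[ae nu].
Proof.
move=> lf f0; have mf := Lfun_measurable lf.
have : ae_eq nu setT (EFin \o f) (cst 0%E).
  apply: (@Lnorm_eq0_eq0 _ _ _ nu _ 2%:E) => //; first exact/measurable_EFinP.
  by rewrite Lnorm2_L2dot// f0 sqrtr0.
by apply: filterS => x /(_ I) /= fx _; apply: EFin_inj.
Qed.

End L2_space.

(** * The embedding of [H] into L_2 and its adjoint *)

Section embedding_adjoint.
Context (R : realType) (d : measure_display) (X : measurableType d).
Context (nu : {measure set X -> \bar R}) (k : X -> X -> R) (H : rkhs k).
Implicit Types f g : H.

Lemma rkhs_funP a f g : rkhs_fun (a *: f + g) = a *: rkhs_fun f + rkhs_fun g.
Proof. by apply/funext => x; rewrite rkhs_fun_linear. Qed.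

Lemma rkhs_fun0 : rkhs_fun (0 : H) = 0.
Proof.
by have := rkhs_funP (-1) 0 0; rewrite scaler0 addr0 scaleN1r addNr.
Qed.

Lemma rkhs_funZ a f : rkhs_fun (a *: f) = a *: rkhs_fun f.
Proof. by have := rkhs_funP a f 0; rewrite rkhs_fun0 !addr0. Qed.

Lemma rkhs_fun_sum (I : Type) (s : seq I) (c : I -> R) (e : I -> H) :
  rkhs_fun (\sum_(i <- s) c i *: e i) =
  (fun x => \sum_(i <- s) c i * rkhs_fun (e i) x).
Proof.
elim: s => [|i s ih].
  by rewrite big_nil rkhs_fun0; apply/funext => x; rewrite big_nil.
by rewrite big_cons rkhs_funP ih; apply/funext => x; rewrite big_cons.
Qed.

Hypothesis H_L2 : L2_embedding_wd nu H.
Hypothesis H_compact : L2_embedding_compact nu H.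

Lemma L2_embedding_compact_dot (u : nat -> H) :
  (exists M, forall n, `|u n| <= M) ->
  exists (phi : nat -> nat) (g : X -> R),
    [/\ {homo phi : m n / (m < n)%N}, g \in Lfun nu 2%:E &
      L2dot nu (rkhs_fun (u (phi n)) - g) (rkhs_fun (u (phi n)) - g)
        @[n --> \oo] --> 0].
Proof.
move=> /H_compact[phi [g [hphi lg ug]]]; exists phi, g; split=> //.
have {ug} : Num.sqrt (L2dot nu (rkhs_fun (u (phi n)) - g)
    (rkhs_fun (u (phi n)) - g)) @[n --> \oo] --> 0.
  move/fine_cvgP : ug => [_]; apply: cvg_trans; apply: near_eq_cvg; near=> n.
  by rewrite /= -[Num.sqrt _]/(fine _%:E) -Lnorm2_L2dot//; exact: Lfun2B.
move=> h; rewrite -[0](mulr0 0).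
under eq_fun do rewrite -[L2dot _ _ _]sqr_sqrtr ?L2dot_ge0// expr2.
exact: cvgM.
Unshelve. all: by end_near. Qed.

(** Otherwise there are unit vectors whose squared L_2 norms exceed every [n], yet by compactness a
    subsequence converges in L_2 and is therefore bounded. *)
Lemma L2_embedding_bounded :
  exists C : R, forall f, L2dot nu (rkhs_fun f) (rkhs_fun f) <= C * `|f| ^+ 2.
Proof.
apply: contrapT => noC.
have ex_v n : exists v : H, `|v| = 1 /\ n%:R < L2dot nu (rkhs_fun v) (rkhs_fun v).
  have [f hf] : exists f : H, n%:R * `|f| ^+ 2 < L2dot nu (rkhs_fun f) (rkhs_fun f).
    apply: contrapT => nof; apply: noC; exists n%:R => f.
    by rewrite leNgt; apply/negP => hf; apply: nof; exists f.
  have f0 : f != 0.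
    apply: contraTneq hf => ->.
    by rewrite rkhs_fun0 normr0 expr0n mulr0 -leNgt L2dot0l.
  exists (`|f|^-1 *: f); split.
    by rewrite normrZ normfV normr_id mulVf ?normr_eq0.
  have lf := H_L2 f; have lf1 := H_L2 (`|f|^-1 *: f).
  rewrite {1}rkhs_funZ L2dotZl// L2dotC rkhs_funZ L2dotZl//.
  by rewrite mulrA -invfM -expr2 mulrC ltr_pdivlMr// exprn_gt0 ?normr_gt0.
have [u uP] := choice ex_v.
have [|phi [g [hphi lg /cvgr0Pnorm_lt ug]]] := @L2_embedding_compact_dot u.
  by exists 1 => n; rewrite (uP n).1.
have phi_ge n : (n <= phi n)%N.
  by elim: n => // n ih; rewrite (leq_ltn_trans ih)// hphi.
have [N _ hN] := ug 1 ltr01.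
(* By [L2dot_le_sub], [b] bounds the squared L_2 norm of any function at squared distance less than
   1 from [g]. *)
pose b := 2 + 2 * L2dot nu (g : X -> R) g.
have b0 : 0 <= b by rewrite addr_ge0// mulr_ge0// L2dot_ge0.
pose n := maxn N (Num.bound b).
have /hN /= : (N <= n)%N by rewrite leq_maxl.
rewrite ger0_norm ?L2dot_ge0// => ugn.
have [_] := uP (phi n); apply/negP; rewrite -leNgt.
rewrite (le_trans (L2dot_le_sub (H_L2 _) lg))// (@le_trans _ _ b)//.
  by rewrite lerD2r -[leRHS]mulr1 ler_wpM2l// ltW.
rewrite (le_trans (ltW (archi_boundP b0)))// ler_nat.
by rewrite (leq_trans _ (phi_ge n))// leq_maxr.
Qed.

(** The Riesz representative in [H] of the functional that pairs with [h] in L_2. For [h] in L_2 and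
    a compact embedding it exists, so the default 0 does not interfere. *)
Definition L2_adjoint (h : X -> R) : H :=
  xget 0 [set m | forall f, rkhs_dot H m f = L2dot nu h (rkhs_fun f)].

Lemma L2_adjointE (h : X -> R) f : h \in Lfun nu 2%:E ->
  rkhs_dot H (L2_adjoint h) f = L2dot nu h (rkhs_fun f).
Proof.
move=> lh; have [C HC] := L2_embedding_bounded.
have [||m mh] := @riesz_representation _ _ _ (@rkhs_normE _ _ _ H)
    (fun f => L2dot nu h (rkhs_fun f)) (Num.sqrt (L2dot nu h h * `|C|)).
- by move=> a g1 g2; rewrite rkhs_funP L2dotC L2dotPl// !(L2dotC _ h).
- move=> g; rewrite -(@ler_pXn2r _ 2) ?nnegrE ?mulr_ge0 ?sqrtr_ge0//.
  rewrite real_normK ?num_real// exprMn sqr_sqrtr ?mulr_ge0 ?L2dot_ge0//.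
  rewrite (le_trans (L2dot_CS lh (H_L2 _)))// -mulrA ler_wpM2l ?L2dot_ge0//.
  by rewrite (le_trans (HC _))// ler_wpM2r ?sqr_ge0// ler_norm.
- rewrite /L2_adjoint; case: xgetP => [_ _ ->//|/(_ m)].
  by case.
Qed.

(** Evaluation at [y] is the inner product with the section at [y]. This is the factorization of
    T_{k,nu} as the embedding after its adjoint. *)
Lemma L2_adjoint_fun (h : X -> R) : (forall x y, k x y = k y x) ->
  h \in Lfun nu 2%:E -> rkhs_fun (L2_adjoint h) = integral_operator nu k h.
Proof.
move=> kC lh; apply/funext => y; rewrite rkhs_reproducing L2_adjointE//.
by apply: eq_Rintegral => x _; rewrite rkhs_sectionE mulrC kC.
Qed.

Lemma L2_adjointP a (h g : X -> R) : h \in Lfun nu 2%:E -> g \in Lfun nu 2%:E ->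
  L2_adjoint (a *: h + g) = a *: L2_adjoint h + L2_adjoint g.
Proof.
move=> lh lg; apply/eqP; rewrite -subr_eq0; apply/eqP.
apply: (dot_eq0 (@rkhs_normE _ _ _ H)).
set f := _ - _; rewrite {1}/f dotBl dotDl dotZl !L2_adjointE ?Lfun2P//.
by rewrite L2dotPl// subrr.
Qed.

Lemma L2_adjointB (h g : X -> R) : h \in Lfun nu 2%:E -> g \in Lfun nu 2%:E ->
  L2_adjoint (h - g) = L2_adjoint h - L2_adjoint g.
Proof.
by move=> lh lg; rewrite addrC -scaleN1r L2_adjointP// scaleN1r addrC.
Qed.

(** The squared norm of [L2_adjoint h] is the L_2 product of [h] with the embedded [L2_adjoint h];
    Cauchy-Schwarz and boundedness of the embedding then allow one squared norm to be cancelled. *)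
Lemma L2_adjoint_bounded : exists C : R, forall h, h \in Lfun nu 2%:E ->
  `|L2_adjoint h| ^+ 2 <= C * L2dot nu h h.
Proof.
have [C HC] := L2_embedding_bounded.
exists `|C| => h lh; have [->|m0] := eqVneq (L2_adjoint h) 0.
  by rewrite normr0 expr0n mulr_ge0// L2dot_ge0.
have n0 : 0 < `|L2_adjoint h| ^+ 2 by rewrite exprn_gt0 ?normr_gt0.
rewrite -(ler_pM2r n0) -expr2 {1}(@rkhs_normE _ _ _ H) L2_adjointE//.
rewrite (le_trans (L2dot_CS lh (H_L2 _)))//.
rewrite mulrC mulrAC ler_wpM2r ?L2dot_ge0// (le_trans (HC _))//.
by rewrite ler_wpM2r ?sqr_ge0// ler_norm.
Qed.

End embedding_adjoint.

(** * Totality of the eigenfunctions in [H] *)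

Section eigensystem_total.
Context (R : realType) (d : measure_display) (X : measurableType d).
Context (nu : {measure set X -> \bar R}) (k : X -> X -> R) (H : rkhs k).
Hypothesis kC : forall x y, k x y = k y x.
Hypothesis H_L2 : L2_embedding_wd nu H.
Hypothesis H_compact : L2_embedding_compact nu H.
Hypothesis H_inj : L2_embedding_inj nu H.
Context (J : countType) (lam : J -> R) (e : J -> H).
Hypothesis lam_e : eigensystem nu lam e.

(** The eigenvalue equation holds only almost everywhere; injectivity of the embedding turns it into
    an identity in [H]. *)
Lemma L2_adjoint_eigen i : L2_adjoint nu H (rkhs_fun (e i)) = lam i *: e i.
Proof.
apply: H_inj; rewrite L2_adjoint_fun// rkhs_funZ.
exact: (eigenE lam_e).
Qed.

(* Otherwise the restriction of [h |-> L2_adjoint h] to the orthogonal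
   complement of the [e i] has an eigenvector, which is missed by [e]. *)
Lemma eigen_rkhs_total (g : H) : (forall i, rkhs_dot H g (e i) = 0) -> g = 0.
Proof.
move=> ge; apply/eqP/negPn/negP => g0.
have [C HC] := L2_adjoint_bounded H_L2 H_compact.
have [C' HC'] := L2_embedding_bounded H_L2 H_compact.
pose T (f : H) : H := L2_adjoint nu H (rkhs_fun f).
pose W := \bigcap_(i in [set: J]) [set f : H | rkhs_dot H f (e i) = 0].
have TE f h : rkhs_dot H (T f) h = L2dot nu (rkhs_fun f) (rkhs_fun h).
  exact: L2_adjointE.
have [||||u u1|||||w [M [Ww w0 M0 Tw]]] := @rayleigh_eigenvector R H (rkhs_dot H)
  (@rkhs_normE _ _ _ H) T (Num.sqrt (`|C| * `|C'|)) _ _ _ _ _ W.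
- by move=> a f h; rewrite /T rkhs_funP L2_adjointP.
- by move=> f h; rewrite TE dotC TE L2dotC.
- by move=> f; rewrite TE L2dot_ge0.
- move=> f; rewrite -(@ler_pXn2r _ 2) ?nnegrE ?mulr_ge0 ?sqrtr_ge0//.
  rewrite exprMn sqr_sqrtr ?mulr_ge0//.
  rewrite (le_trans (HC _ (H_L2 _)))//.
  rewrite (@le_trans _ _ (`|C| * L2dot nu (rkhs_fun f) (rkhs_fun f)))//.
    by rewrite ler_wpM2r ?L2dot_ge0// ler_norm.
  rewrite -mulrA ler_wpM2l// (le_trans (HC' _))//.
  by rewrite ler_wpM2r ?sqr_ge0// ler_norm.
(* The compact embedding yields a subsequence converging in L_2, and the bounded adjoint carries the
   convergence over to [H]. *)
- have [|phi [h [hphi lh uh]]] := L2_embedding_compact_dot H_L2 H_compact (u := u).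
    by exists 1 => n; rewrite u1.
  exists phi, (L2_adjoint nu H h); split=> //.
  apply/cvgrPdist_lt => eps eps0; near=> n.
  rewrite distrC /T -(L2_adjointB H_L2 H_compact)//.
  rewrite -(@ltr_pXn2r _ 2) ?nnegrE// ?ltW//.
  rewrite (le_lt_trans (HC _ (Lfun2B (H_L2 _) lh)))//.
  rewrite (@le_lt_trans _ _ ((`|C| + 1) * L2dot nu (rkhs_fun (u (phi n)) - h)
      (rkhs_fun (u (phi n)) - h)))//.
    by rewrite ler_wpM2r ?L2dot_ge0// (le_trans (ler_norm _))// lerDl.
  rewrite mulrC -ltr_pdivlMr ?ltr_wpDl//.
  rewrite (le_lt_trans (ler_norm _))//; near: n.
  move/cvgr0Pnorm_lt : uh; apply.
  by rewrite divr_gt0 ?exprn_gt0// ltr_wpDl.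
- apply: closed_bigI => i _.
  apply: (@preimage_closed _ _ (fun f => rkhs_dot H f (e i)) [set x | x = 0]).
    move=> x _; exact: (cvg_dotl (@rkhs_normE _ _ _ H)).
  exact: closed_eq.
- by move=> a f h Wf Wh i _ /=; rewrite dotDl dotZl Wf// Wh// mulr0 addr0.
- move=> f Wf i _ /=; rewrite TE L2dotC -(L2_adjointE H_L2 H_compact)//.
  by rewrite L2_adjoint_eigen dotZl dotC Wf// mulr0.
(* Injectivity of the embedding makes the form of [T] definite, so it does not vanish at [g]. *)
- exists g; first by move=> i _; exact: ge.
  apply: contra_neq g0; rewrite TE => /(L2dot_eq0 (H_L2 g)) g0.
  by apply: H_inj; rewrite rkhs_fun0.
(* The eigenvector [w] is a finite combination of the [e i], and as an element of [W] it is
   orthogonal to each of them; hence [w = 0]. *)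
have [|s [c [_ wE]]] := eigen_total lam_e M0 (H_L2 w).
  by apply: aeW => x _; rewrite -(L2_adjoint_fun H_L2 H_compact)// -/(T w) Tw rkhs_funZ.
have wE' : w = \sum_(i <- s) c i *: e i.
  by apply: H_inj; rewrite rkhs_fun_sum.
move/eqP : w0; apply; apply: (dot_eq0 (@rkhs_normE _ _ _ H)).
rewrite {1}wE' dot_suml big1// => i _.
by rewrite dotZl dotC Ww// mulr0.
Unshelve. all: by end_near. Qed.

End eigensystem_total.

(** * Integration against a probability with a density *)

Section density.
Context (R : realType) (d : measure_display) (X : measurableType d).
Context (nu : {sigma_finite_measure set X -> \bar R}).
Context (P : probability X R) (h : X -> R).
Hypothesis hi : h \in Lfun nu 1%E.
Hypothesis Ph : has_density nu P h.

Let mh : measurable_fun setT (EFin \o h).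
Proof. by apply/measurable_EFinP; exact: Lfun_measurable hi. Qed.

Lemma has_density_dominates : P `<< nu.
Proof.
apply/null_content_dominatesP => A mA nuA; rewrite Ph//.
by rewrite null_set_integral//; exact: measurable_funTS.
Qed.

Let RN := Radon_Nikodym_SigmaFinite.f P nu.

Let mRN := Radon_Nikodym_SigmaFinite.f_integrable has_density_dominates.

Let RNh : ae_eq nu setT RN (EFin \o h).
Proof.
apply: integral_ae_eq => //.
move=> A _ mA.
rewrite -(Radon_Nikodym_SigmaFinite.f_integral has_density_dominates mA).
exact: Ph.
Qed.

Context (f : X -> R) (mf : measurable_fun setT f).
Hypothesis fh : nu.-integrable setT (EFin \o (fun x => f x * h x)).

(** Change of variables introduces the derivative [RN], which is almost everywhere [h] because both
    have the same integrals over measurable sets. *)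
Lemma has_density_integrable : P.-integrable setT (EFin \o f).
Proof.
apply/integrableP; split; first exact/measurable_EFinP.
rewrite -(Radon_Nikodym_SigmaFinite.change_of_variables has_density_dominates)//.
  case/integrableP : fh => _; apply: le_lt_trans.
  rewrite le_eqVlt; apply/orP; left; apply/eqP; apply: ae_eq_integral => //.
  - apply: emeasurable_funM => //.
      by apply: measurableT_comp => //; exact/measurable_EFinP.
    exact: measurable_int mRN.
  - by apply: measurableT_comp => //; exact: measurable_int fh.
  - apply: filterS RNh => x RNx _.
    (* The sign of [h x] is read off from the derivative. *)
    have : (0 <= RN x)%E.
      exact: (Radon_Nikodym_SigmaFinite.f_ge0 has_density_dominates).
    rewrite /= -/(RN x) RNx//= lee_fin => h0.
    by rewrite -EFinM normrM (ger0_norm h0).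
by apply: measurableT_comp => //; exact/measurable_EFinP.
Qed.

Lemma has_density_Rintegral : \int[P]_x f x = \int[nu]_x (f x * h x).
Proof.
rewrite /Rintegral; congr fine.
rewrite -(Radon_Nikodym_change_of_variables has_density_dominates)//; last first.
  exact: has_density_integrable.
apply: ae_eq_integral => //.
- apply: emeasurable_funM; first exact/measurable_EFinP.
  apply: measurable_int; apply: Radon_Nikodym_integrable.
  exact: has_density_dominates.
- exact: measurable_int fh.
(* The change of variables used here is for the general derivative, whereas [RNh] concerns the
   sigma-finite one; the two agree almost everywhere. *)
- have := ae_eq_Radon_Nikodym_SigmaFinite has_density_dominates measurableT.
  move: RNh; apply: filterS2 => x RNx RNx' _.
  by rewrite -RNx'// -/(RN x) RNx// EFinM.
Qed.

End density.

(** * Kernel means of densities *)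

Section kernel_mean_density.
Context (R : realType) (d : measure_display) (X : measurableType d).
Context (nu : {sigma_finite_measure set X -> \bar R}) (k : X -> X -> R) (H : rkhs k).
Hypothesis H_L2 : L2_embedding_wd nu H.
Hypothesis H_compact : L2_embedding_compact nu H.

(** By the reproducing property, pairing the sections with [f] gives the values of [f], whose
    integral against [P] is the L_2 product of [f] and [h]. *)
Lemma kernel_mean_embedding_density (P : probability X R) h :
  Delta nu h -> has_density nu P h ->
  kernel_mean_embedding H P = L2_adjoint nu H h.
Proof.
move=> [lh hi _ _] Ph.
have PS : is_pettis_integral P (rkhs_section H) (L2_adjoint nu H h).
  move=> f.
  have -> : (fun x => rkhs_dot H f (rkhs_section H x)) = rkhs_fun f.
    by apply/funext => x; rewrite -rkhs_reproducing.
  under eq_fun do rewrite -rkhs_reproducing.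
  have mf := Lfun_measurable (H_L2 f).
  have fh := Lfun2_mul_integrable (H_L2 f) lh.
  split; first exact: has_density_integrable fh.
  by rewrite dotC L2_adjointE// L2dotC (has_density_Rintegral hi Ph mf fh).
rewrite /kernel_mean_embedding /pettis_integral.
(* Two Pettis integrals have the same inner product with every element of [H], in particular with
   their difference. *)
case: xgetP => [m _ Pm|/(_ _ PS)//].
apply/eqP; rewrite -subr_eq0; apply/eqP; apply: (dot_eq0 (@rkhs_normE _ _ _ H)).
by rewrite {1}dotBr (PS _).2 (Pm _).2 subrr.
Qed.

End kernel_mean_density.

(** * Total variation distance as an L_1 distance of densities *)

Section total_variation_density.
Context (R : realType) (d : measure_display) (X : measurableType d).
Context (nu : {measure set X -> \bar R}).

(** The set where [g <= h] and its complement form a Hahn decomposition of [P - Q]; by uniqueness it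
    may replace the chosen one, and the two parts add up to the integral of the absolute value. *)
Lemma tv_dist_density (P Q : probability X R) h g :
  h \in Lfun nu 1%E -> g \in Lfun nu 1%E ->
  has_density nu P h -> has_density nu Q g ->
  tv_dist P Q = (\int[nu]_x `|h x - g x|%:E)%E.
Proof.
move=> lh lg Ph Qg.
have ih := (Lfun1_integrable nu h).1 lh.
have ig := (Lfun1_integrable nu g).1 lg.
have mh := Lfun_measurable lh.
have mg := Lfun_measurable lg.
have ihg : nu.-integrable setT (EFin \o (fun x => h x - g x)).
  by apply: eq_integrable (integrableB measurableT ih ig).
have ihgS A : measurable A -> nu.-integrable A (EFin \o (fun x => h x - g x)).
  by move=> mA; apply: integrableS ihg.
set mu : {charge set X -> \bar R} := cadd (charge_of_finite_measure P)
  (copp (charge_of_finite_measure Q)).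
have muE A : measurable A -> mu A = (\int[nu]_(x in A) (h x - g x)%:E)%E.
  move=> mA; rewrite -[LHS]/(P A - Q A)%E Ph// Qg//.
  by rewrite -integralB_EFin//; [exact: integrableS ih|exact: integrableS ig].
pose D := [set x | g x <= h x].
have mD : measurable D.
  by rewrite -[D]setTI; exact: measurable_fun_le.
have hahnD : hahn_decomposition mu D (~` D).
  split.
  - split=> // A mA AD; rewrite muE//; apply: integral_ge0 => x Ax.
    by rewrite lee_fin subr_ge0 AD.
  - split=> [|A mA AD]; first exact: measurableC.
    rewrite muE// -oppe_ge0 -integralN/=; last first.
      exact: integrable_add_def (ihgS _ mA).
    apply: integral_ge0 => x Ax; rewrite lee_fin opprB subr_ge0.
    by apply/ltW; rewrite ltNge; apply/negP; exact: AD.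
  - exact: setUv.
  - exact: setICr.
have [|mup mun] := Hahn_decomposition_uniq (projT2 (cid (hahn_ex mu))) hahnD (S := setT).
  exact: measurableT.
rewrite /tv_dist /tv_norm -/mu /charge_variation.
rewrite jordan_posE jordan_negE cjordan_posE cjordan_negE /crestr0 mem_set//= /crestr.
rewrite mup mun !setTI !muE//; last exact: measurableC.
rewrite -(setUv D) ge0_integral_setU//=; last 3 first.
- exact: measurableC.
- by rewrite setUv; apply/measurable_EFinP/measurableT_comp => //; exact: measurable_funB.
- by apply/disj_setPCl.
congr (_ + _)%E.
  by apply: eq_integral => x; rewrite inE => Dx; rewrite ger0_norm ?subr_ge0.
rewrite -integralN/=; last first.
  apply: integrable_add_def; first exact: measurableC.
  exact: ihgS _ (measurableC mD).
apply: eq_integral => x; rewrite inE => Dx; rewrite ler0_norm// subr_le0.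
by apply/ltW; rewrite ltNge; apply/negP.
Qed.

End total_variation_density.

(** * Densities: mixtures, splitting, uniqueness *)

Section Delta_densities.
Context (R : realType) (d : measure_display) (X : measurableType d).
Context (nu : {measure set X -> \bar R}).
Implicit Types f g h : X -> R.

Lemma Lfun1P a f g : f \in Lfun nu 1%E -> g \in Lfun nu 1%E ->
  a *: f + g \in Lfun nu 1%E.
Proof. by move=> lf lg; apply: (Lfun_submod_closed nu (lexx 1%E)).2. Qed.

Lemma Lfun1Z a f : f \in Lfun nu 1%E -> a *: f \in Lfun nu 1%E.
Proof.
move=> lf; rewrite -[a *: f]addr0; apply: Lfun1P => //.
exact: (Lfun_submod_closed nu (lexx 1%E)).1.
Qed.

Lemma Lfun1D f g : f \in Lfun nu 1%E -> g \in Lfun nu 1%E ->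
  f + g \in Lfun nu 1%E.
Proof. by move=> lf lg; rewrite -[f]scale1r; exact: Lfun1P. Qed.

Lemma Lfun1B f g : f \in Lfun nu 1%E -> g \in Lfun nu 1%E ->
  f - g \in Lfun nu 1%E.
Proof. by move=> lf lg; rewrite addrC -scaleN1r; exact: Lfun1P. Qed.

Lemma Rintegral1P a f g : f \in Lfun nu 1%E -> g \in Lfun nu 1%E ->
  \int[nu]_x (a *: f + g) x = a * \int[nu]_x f x + \int[nu]_x g x.
Proof.
move=> /Lfun1_integrable lf /Lfun1_integrable lg.
rewrite -RintegralZl// -RintegralD//.
by apply: eq_integrable (integrableZl measurableT a lf).
Qed.

Lemma integral_Rintegral f : f \in Lfun nu 1%E ->
  (\int[nu]_x (f x)%:E = (\int[nu]_x f x)%:E)%E.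
Proof. by move=> /Lfun1_integrable lf; rewrite /Rintegral fineK// integrable_fin_num. Qed.

Lemma Lfun2_norm f : f \in Lfun nu 2%:E -> Num.norm \o f \in Lfun nu 2%:E.
Proof.
case/andP; rewrite !inE/= => mf finf; apply/andP; split.
  by rewrite inE/=; exact: measurableT_comp.
rewrite inE/= /finite_norm.
under [X in Lnorm _ _ X]eq_fun do rewrite /= -abse_EFin.
by rewrite Lnorm_abse.
Qed.

Lemma DeltaI h : h \in Lfun nu 2%:E -> h \in Lfun nu 1%E ->
  {ae nu, forall x, 0 <= h x} -> \int[nu]_x h x = 1 -> Delta nu h.
Proof. by move=> h2 h1 h0 hI; split=> //; rewrite integral_Rintegral// hI. Qed.

Lemma Delta_Rintegral h : Delta nu h -> \int[nu]_x h x = 1.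
Proof. by case=> _ _ _; rewrite /Rintegral => ->. Qed.

Lemma Delta_norm h : Delta nu h -> \int[nu]_x `|h x| = 1.
Proof.
move=> hD; rewrite -(Delta_Rintegral hD); have [_ h1 h0 _] := hD.
rewrite /Rintegral; congr fine; apply: ae_eq_integral => //.
- exact/measurable_EFinP/measurableT_comp/(Lfun_measurable h1).
- exact/measurable_EFinP/(Lfun_measurable h1).
- by apply: filterS h0 => x hx _; rewrite ger0_norm.
Qed.

Lemma Delta_convex t h g : 0 <= t <= 1 -> Delta nu h -> Delta nu g ->
  Delta nu ((1 - t) *: h + t *: g).
Proof.
move=> /andP[t0 t1] hD gD; have [h2 h1 h0 _] := hD; have [g2 g1 g0 _] := gD.
have -> : (1 - t) *: h + t *: g = t *: (g - h) + h.
  by rewrite scalerBr scalerBl scale1r [RHS]addrC addrA addrAC.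
apply: DeltaI.
- by rewrite Lfun2P// Lfun2B.
- by rewrite Lfun1P// Lfun1B.
- move: h0 g0; apply: filterS2 => x hx gx.
  have -> : (t *: (g - h) + h) x = (1 - t) * h x + t * g x.
    by rewrite !fctE /GRing.scale/=; ring.
  by rewrite addr_ge0// mulr_ge0// subr_ge0.
- rewrite Rintegral1P ?Lfun1B//.
  rewrite [g - h]addrC -scaleN1r Rintegral1P// !Delta_Rintegral//; ring.
Qed.

Lemma Rintegral_norm_gt0 f : f \in Lfun nu 1%E -> ~ (f = cst 0 %[ae nu]) ->
  0 < \int[nu]_x `|f x|.
Proof.
move=> lf nf; rewrite lt_neqAle Rintegral_ge0// andbT eq_sym.
apply/eqP => f0; apply: nf.
have : ae_eq nu setT (EFin \o f) (cst 0%E).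
  apply/ae_eq_integral_abs => //; first exact/measurable_EFinP/(Lfun_measurable lf).
  have := integral_Rintegral (Lfun_norm lf).
  by rewrite /= f0.
by apply: filterS => x /(_ I) /= fx _; apply: EFin_inj.
Qed.

(* [h1] and [h2] are the normalized positive and negative parts of [f]. *)
Lemma Delta_split f : f \in Lfun nu 1%E -> f \in Lfun nu 2%:E ->
  ~ (f = cst 0 %[ae nu]) -> \int[nu]_x f x = 0 ->
  exists h1 h2 c, [/\ Delta nu h1, Delta nu h2, 0 < c, h1 - h2 = c *: f &
    \int[nu]_x `|(h1 - h2) x| = 2].
Proof.
move=> f1 f2 nf f0; have n0 := Rintegral_norm_gt0 f1 nf.
set n := (X in 0 < X) in n0.
pose af : X -> R := Num.norm \o f.
have nf1 : af \in _ := Lfun_norm f1.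
have nf2 : af \in _ := Lfun2_norm f2.
have nE : \int[nu]_x af x = n by [].
have zf p : (1 <= p)%E -> 0 \in Lfun nu p.
  by move=> p1; exact: (Lfun_submod_closed nu p1).1.
(* For [s] equal to 1 or -1, [s *: f + af] is twice the positive or negative part of [f]; its
   integral is [n] because that of [f] is 0. *)
have halfD (s : R) : s ^+ 2 = 1 -> Delta nu (n^-1 *: (s *: f + af)).
  move=> s1; rewrite -[n^-1 *: _]addr0; apply: DeltaI.
  - by rewrite !Lfun2P// zf// lee1n.
  - by rewrite !Lfun1P// zf.
  - apply: aeW => x; rewrite -[X in 0 <= X]/(n^-1 * (s * f x + `|f x|) + 0).
    rewrite addr0 mulr_ge0 ?invr_ge0 ?(ltW n0)// -lerBlDl sub0r.
    rewrite (le_trans (ler_norm _))// normrN normrM.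
    have -> : `|s| = 1 by apply/eqP; rewrite -sqrp_eq1// real_normK ?num_real// s1.
    by rewrite mul1r.
  - rewrite !Rintegral1P ?Lfun1P ?zf// f0 nE mulr0 add0r mulVf ?gt_eqF//.
    by rewrite Rintegral_cst// mul0r addr0.
(* The terms [af] cancel in the difference, which leaves [f] with the factor [2 / n]. *)
exists (n^-1 *: (1 *: f + af)), (n^-1 *: (-1 *: f + af)), (2 / n).
have E : n^-1 *: (1 *: f + af) - n^-1 *: (-1 *: f + af) = (2 / n) *: f.
  by apply/funext => x; rewrite !fctE /GRing.scale/=; ring.
split=> //.
- by apply: halfD; rewrite expr1n.
- by apply: halfD; rewrite sqrrN expr1n.
- by rewrite divr_gt0.
- rewrite E; transitivity (\int[nu]_x ((2 / n) * `|f x|)).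
    apply: eq_Rintegral => x _; rewrite normrM ger0_norm//.
    by rewrite divr_ge0// ltW.
  rewrite RintegralZl//; last exact/Lfun1_integrable.
  by rewrite -/n divfK// gt_eqF.
Qed.

Lemma has_density_same (P Q : probability X R) h g :
  h \in Lfun nu 1%E -> g \in Lfun nu 1%E ->
  has_density nu P h -> has_density nu Q g ->
  same_measure P Q <-> h = g %[ae nu].
Proof.
move=> lh lg Ph Qg.
have mg : measurable_fun setT (EFin \o g) by exact/measurable_EFinP/(Lfun_measurable lg).
have mh : measurable_fun setT (EFin \o h) by exact/measurable_EFinP/(Lfun_measurable lh).
split=> [PQ|hg A mA].
  have : ae_eq nu setT (EFin \o h) (EFin \o g).
    apply: integral_ae_eq => //; first exact/Lfun1_integrable.
    by move=> A _ mA; rewrite -[LHS]Ph// -[RHS]Qg// PQ.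
  by apply: filterS => x /(_ I) /= [].
rewrite Ph// Qg//; apply: ae_eq_integral => //; try exact: measurable_funTS.
by apply: filterS hg => x /(_ I) /= ->.
Qed.

End Delta_densities.

(** * The kernel mean distance of two densities *)

Section kernel_mean_distance.
Context (R : realType) (d : measure_display) (X : measurableType d).
Context (nu : {sigma_finite_measure set X -> \bar R}) (k : X -> X -> R) (H : rkhs k).
Hypothesis kC : forall x y, k x y = k y x.
Hypothesis H_L2 : L2_embedding_wd nu H.
Hypothesis H_compact : L2_embedding_compact nu H.
Context (h g : X -> R) (P Q : probability X R).
Hypotheses (hD : Delta nu h) (gD : Delta nu g).
Hypotheses (Ph : has_density nu P h) (Qg : has_density nu Q g).

Let h2 : h \in Lfun nu 2%:E. Proof. by case: hD. Qed.
Let g2 : g \in Lfun nu 2%:E. Proof. by case: gD. Qed.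

Lemma kernel_mean_dist_sqr : kernel_mean_dist H P Q ^+ 2
  = rkhs_dot H (L2_adjoint nu H (h - g)) (L2_adjoint nu H (h - g)).
Proof.
rewrite /kernel_mean_dist (kernel_mean_embedding_density H_L2 H_compact hD Ph).
rewrite (kernel_mean_embedding_density H_L2 H_compact gD Qg).
by rewrite L2_adjointB// -rkhs_normE.
Qed.

(** By the adjoint relation, [h - g] is orthogonal to [H] exactly when its image under [L2_adjoint]
    is 0. *)
Lemma kernel_mean_dist_eq0 :
  kernel_mean_dist H P Q ^+ 2 = 0 <-> L2_perp nu H (h - g).
Proof.
rewrite kernel_mean_dist_sqr; split=> [/(dot_eq0 (@rkhs_normE _ _ _ H)) Shg|[_ hg]].
  split=> [|f]; first exact: Lfun2B.
  by rewrite -(L2_adjointE H_L2 H_compact) ?Lfun2B// Shg dot0l.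
by rewrite L2_adjointE// ?Lfun2B.
Qed.

Lemma kernel_mean_dist_esum (H_inj : L2_embedding_inj nu H)
    (J : countType) (lam : J -> R) (e : J -> H) : eigensystem nu lam e ->
  ((kernel_mean_dist H P Q ^+ 2)%:E =
    \esum_(i in [set: J]) (lam i * L2dot nu (h - g) (rkhs_fun (e i)) ^+ 2)%:E)%E.
Proof.
move=> lam_e; rewrite kernel_mean_dist_sqr.
rewrite -(parseval (@rkhs_normE _ _ _ H) (eigen_orthonormal_rkhs lam_e)).
  apply: eq_esum => i _; rewrite dotZr exprMn sqr_sqrtr ?(ltW (eigen_gt0 lam_e i))//.
  by rewrite L2_adjointE// Lfun2B.
(* The factors [Num.sqrt (lam i)] are nonzero, so the scaled system is total because the [e i]
   are. *)
move=> f fe; apply: (eigen_rkhs_total kC H_L2 H_compact H_inj lam_e) => i.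
have /eqP := fe i; rewrite dotZr mulf_eq0 gt_eqF/= => [/eqP//|].
by rewrite sqrtr_gt0 (eigen_gt0 lam_e).
Qed.

End kernel_mean_distance.

(** * Total variation distances of mixtures *)

Section total_variation_of_mixtures.
Context (R : realType) (d : measure_display) (X : measurableType d).
Context (nu : {measure set X -> \bar R}) (t : R) (h h1 h2 : X -> R).
Hypotheses (t01 : 0 <= t <= 1) (hD : Delta nu h).
Hypotheses (h1D : Delta nu h1) (h2D : Delta nu h2).

Let mix g := (1 - t) *: h + t *: g.

Lemma tv_dist_Rintegral (P Q : probability X R) (f g : X -> R) :
  f \in Lfun nu 1%E -> g \in Lfun nu 1%E ->
  has_density nu P f -> has_density nu Q g ->
  tv_dist P Q = (\int[nu]_x `|f x - g x|)%:E.
Proof.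
move=> lf lg Pf Qg; rewrite (tv_dist_density lf lg Pf Qg).
by rewrite -(integral_Rintegral (Lfun_norm (Lfun1B lf lg))).
Qed.

(** The density difference is [t] times [h - h1], and two densities are at L_1 distance at most
    2. *)
Lemma tv_dist_mixture (P Q : probability X R) : has_density nu P h ->
  has_density nu Q (mix h1) -> (tv_dist P Q <= (2 * t)%:E)%E.
Proof.
move=> Ph Q1; have [t0 t1] := andP t01.
have [_ lh _ _] := hD; have [_ lh1 _ _] := h1D.
have [_ lm _ _] := Delta_convex t01 hD h1D.
rewrite (tv_dist_Rintegral lh lm Ph Q1) lee_fin.
have nh := Lfun_norm lh; have nh1 := Lfun_norm lh1.
have -> : 2 * t = \int[nu]_x (t * (`|h x| + `|h1 x|)).
  rewrite RintegralZl//; last exact/Lfun1_integrable/(Lfun1D nh nh1).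
  rewrite RintegralD ?Delta_norm//; try exact/Lfun1_integrable.
  by rewrite mulrC.
apply: le_Rintegral => //.
- exact/Lfun1_integrable/(Lfun_norm (Lfun1B lh lm)).
- exact/Lfun1_integrable/(Lfun1Z t (Lfun1D nh nh1)).
- move=> x _; have -> : h x - mix h1 x = t * (h x - h1 x).
    by rewrite /mix !fctE /GRing.scale/=; ring.
  by rewrite normrM (ger0_norm t0) ler_wpM2l// ler_normB.
Qed.

(** The common component [h] cancels in the difference. *)
Lemma tv_dist_mixtures (Q1 Q2 : probability X R) :
  has_density nu Q1 (mix h1) -> has_density nu Q2 (mix h2) ->
  tv_dist Q1 Q2 = (t * \int[nu]_x `|(h1 - h2) x|)%:E.
Proof.
move=> Q1h Q2h; have [t0 t1] := andP t01.
have [_ l1 _ _] := Delta_convex t01 hD h1D.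
have [_ l2 _ _] := Delta_convex t01 hD h2D.
have [_ lh1 _ _] := h1D; have [_ lh2 _ _] := h2D.
rewrite (tv_dist_Rintegral l1 l2 Q1h Q2h) -RintegralZl//; last first.
  exact/Lfun1_integrable/(Lfun_norm (Lfun1B lh1 lh2)).
congr (_%:E); apply: eq_Rintegral => x _.
have -> : mix h1 x - mix h2 x = t * (h1 - h2) x.
  by rewrite /mix !fctE /GRing.scale/=; ring.
by rewrite normrM ger0_norm.
Qed.

End total_variation_of_mixtures.

(** * The series formula, the cycle of implications and the indistinguishable mixtures *)

Theorem theorem3p10 (R : realType) (d : measure_display)
    (X : measurableType d) (nu : {sigma_finite_measure set X -> \bar R})
    (k : X -> X -> R) (k_kernel : psd_kernel k)
    (k_measurable : measurable_fun [set: X * X] (fun p => k p.1 p.2))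
    (k_bounded : bounded_kernel k)
    (H : rkhs k)
    (H_L2 : L2_embedding_wd nu H)
    (H_compact : L2_embedding_compact nu H)
    (H_inj : L2_embedding_inj nu H)
    (J : countType) (lam : J -> R) (e : J -> H)
    (lam_e : eigensystem nu lam e) :
  (forall (h g : X -> R) (P Q : probability X R),
     Delta nu h -> Delta nu g -> has_density nu P h -> has_density nu Q g ->
     ((kernel_mean_dist H P Q ^+ 2)%:E =
       \esum_(i in [set: J]) (lam i * L2dot nu (h \- g)%R (rkhs_fun (e i)) ^+ 2)%:E)%E)
  /\
  let cond_i := exists Q1 Q2 : probability X R,
    [/\ P2 nu Q1, P2 nu Q2, ~ same_measure Q1 Q2 &
        kernel_mean_dist H Q1 Q2 ^+ 2 = 0] in
  let cond_ii := exists f : X -> R,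
    [/\ f \in Lfun nu 1%E, L2_perp nu H f, ~ (f = cst 0 %[ae nu]) &
        \int[nu]_x f x = 0] in
  let cond_iii := exists h1 h2 : X -> R,
    [/\ Delta nu h1, Delta nu h2, ~ (h1 = h2 %[ae nu]) &
        forall i, L2dot nu h1 (rkhs_fun (e i)) = L2dot nu h2 (rkhs_fun (e i))] in
  [/\ cond_i <-> cond_ii, cond_ii <-> cond_iii &
      cond_i \/ cond_ii \/ cond_iii ->
      forall (P : probability X R) (eps : R), P2 nu P -> 0 < eps < 2 ->
      exists Q1 Q2 : probability X R,
        [/\ P2 nu Q1 /\ P2 nu Q2,
            (tv_dist P Q1 <= eps%:E)%E /\ (tv_dist P Q2 <= eps%:E)%E,
            tv_dist Q1 Q2 = eps%:E &
            kernel_mean_dist H Q1 Q2 ^+ 2 = 0]].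
Proof.
have kC := k_kernel.1.
split=> [h g P Q hD gD Ph Qg|cond_i cond_ii cond_iii].
  exact: (kernel_mean_dist_esum kC H_L2 H_compact hD gD Ph Qg H_inj lam_e).
have i_ii : cond_i -> cond_ii.
  move=> [Q1 [Q2 [[h1 h1D Q1h] [h2 h2D Q2h] Q12 g0]]].
  have [_ l1 _ _] := h1D; have [_ l2 _ _] := h2D.
  exists (h1 - h2); split.
  - exact: Lfun1B.
  - exact/(kernel_mean_dist_eq0 H_L2 H_compact h1D h2D Q1h Q2h).
  - move=> h12; apply: Q12; apply/(has_density_same l1 l2 Q1h Q2h).
    by apply: filterS h12 => x h0 _; apply: subr0_eq; exact: h0 I.
  - by rewrite addrC -scaleN1r Rintegral1P// !Delta_Rintegral// mulr1 addNr.
(* This pair of densities serves both for (iii) and for the mixtures at the end. *)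
have ii_split : cond_ii -> exists h1 h2 : X -> R,
    [/\ Delta nu h1, Delta nu h2, ~ (h1 = h2 %[ae nu]), L2_perp nu H (h1 - h2) &
      \int[nu]_x `|(h1 - h2) x| = 2].
  move=> [f [f1 [f2 fH] nf f0]].
  have [h1 [h2 [c [h1D h2D c0 h12 I2]]]] := Delta_split f1 f2 nf f0.
  exists h1, h2; split=> //.
  - move=> h12ae; apply: nf; apply: filterS h12ae => x /(_ I) h12x _.
    have : h1 x - h2 x = c * f x := congr1 (fun u => u x) h12.
    by rewrite h12x subrr => /esym/eqP; rewrite mulf_eq0 (gt_eqF c0) => /eqP.
  - split=> [|g]; first by rewrite Lfun2B//; [case: h1D|case: h2D].
    by rewrite h12 L2dotZl// fH mulr0.
have ii_iii : cond_ii -> cond_iii.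
  move=> /ii_split[h1 [h2 [h1D h2D h12 [_ h12H] _]]].
  exists h1, h2; split=> // i; apply/eqP; rewrite -subr_eq0; apply/eqP.
  by have [l1 _ _ _] := h1D; have [l2 _ _ _] := h2D; rewrite -L2dotBl.
have iii_i : cond_iii -> cond_i.
  move=> [h1 [h2 [h1D h2D h12 h12e]]].
  have [l1 l1' _ _] := h1D; have [l2 l2' _ _] := h2D.
  have [Q1 Q1h] := Delta_has_density h1D.
  have [Q2 Q2h] := Delta_has_density h2D.
  exists Q1, Q2; split; [by exists h1|by exists h2| |].
    by move/(has_density_same l1' l2' Q1h Q2h).
  (* Equal coefficients make every term of the series vanish. *)
  have := kernel_mean_dist_esum kC H_L2 H_compact h1D h2D Q1h Q2h H_inj lam_e.
  rewrite esum1 => [[]//|i _].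
  by rewrite L2dotBl// h12e subrr expr0n mulr0.
split; [split=> // /ii_iii/iii_i //|split=> // /iii_i/i_ii //|].
move=> conds P eps [h hD Ph] /andP[eps0 eps2].
have {conds} : cond_ii by case: conds => [/i_ii|[|/iii_i/i_ii]].
move=> /ii_split[h1 [h2 [h1D h2D h12 [h12l h12H] I2]]].
(* The mixing weight is [eps / 2] because [h1] and [h2] are at L_1 distance 2. *)
have t01 : 0 <= eps / 2 <= 1.
  by rewrite divr_ge0 ?(ltW eps0)//= ler_pdivrMr// mul1r ltW.
have q1D := Delta_convex t01 hD h1D; have q2D := Delta_convex t01 hD h2D.
have [Q1 Q1h] := Delta_has_density q1D.
have [Q2 Q2h] := Delta_has_density q2D.
have epsE : 2 * (eps / 2) = eps by rewrite mulrC divfK.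
exists Q1, Q2; split.
- by split; [exists ((1 - eps / 2) *: h + (eps / 2) *: h1)|
    exists ((1 - eps / 2) *: h + (eps / 2) *: h2)].
- by rewrite -epsE; split;
    [exact: (tv_dist_mixture t01 hD h1D Ph Q1h)
    |exact: (tv_dist_mixture t01 hD h2D Ph Q2h)].
- by rewrite (tv_dist_mixtures t01 hD h1D h2D Q1h Q2h) I2 mulrC epsE.
- apply/(kernel_mean_dist_eq0 H_L2 H_compact q1D q2D Q1h Q2h).
  (* The mixtures differ by a multiple of [h1 - h2], which is orthogonal to [H]. *)
  rewrite opprD addrACA subrr add0r -scalerBr.
  split=> [|f]; first exact: Lfun2Z.
  by rewrite L2dotZl// h12H mulr0.
Qed.
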